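(* Let $\chi$ be a finite or countable alphabet, let $\mu,\nu$ be stationary probability measures on $\chi^{\mathbb{N}}$, and suppose $\nu$ has complete grammar. Then the sequence of random variables $n-T_n^{(2)}$, defined on $(\chi^{\mathbb{N}}\times\chi^{\mathbb{N}},\ \mu\times\nu)$, does not converge in probability as $n\to\infty$.
   Context: $\sigma$ is the left shift on $\chi^{\mathbb{N}}$, $\mathbb{N}=\{0,1,2,\dots\}$, and $x_m^n=x_mx_{m+1}\cdots x_n$. A string $\omega\in\chi^n$ is identified with the cylinder $\{\mathbf{x}\in\chi^{\mathbb{N}}: x_0^{n-1}=\omega\}$. Stationary means $\sigma$-invariant. The measure $\nu$ has complete grammar if $\nu(\omega)>0$ for all $n\ge1$ and all $\omega\in\chi^n$. Shortest-path function: $T_n^{(2)}(\mathbf{x},\mathbf{y})=\inf\{k\ge 1: y_0^{n-1}\cap\sigma^{-k}(x_0^{n-1})\ne\emptyset\}$. Convergence in probability means convergence to a (finite) real-valued random variable. *)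

(* Defs.v *)
From HB Require Import structures.
From mathcomp Require Import all_boot all_order all_algebra.
From mathcomp Require Import all_classical all_reals all_analysis.

Set Implicit Arguments.
Unset Strict Implicit.
Unset Printing Implicit Defensive.

Import Order.TTheory GRing.Theory Num.Theory.
Import numFieldNormedType.Exports.

Local Open Scope classical_set_scope.
Local Open Scope ring_scope.

(* Nonempty finite or countable alphabets. The library only puts sigma-algebras
   on pointed types; the chosen point plays no other role, and an empty alphabet
   carries no probability measure. *)
#[short(type="alphabetType")]
HB.structure Definition Alphabet := {T of Countable T & Pointed T}.

Section SequenceSpace.
Context {chi : alphabetType}.

(* [mkseq x n] is the string x_0 ... x_(n-1) *)
Definition cylinder (w : seq chi) : set (nat -> chi) :=
  [set x | mkseq x (size w) = w].

Definition cylinders : set (set (nat -> chi)) := range cylinder.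

Definition shift (x : nat -> chi) : nat -> chi := fun i => x i.+1.

End SequenceSpace.

Arguments cylinders : clear implicits.

(* chi^N with the product of the discrete sigma-algebras *)
Notation seqspace chi := (g_sigma_algebraType (cylinders chi)).

Definition stationary (chi : alphabetType) (R : realType)
    (mu : probability (seqspace chi) R) :=
  forall A : set (seqspace chi), measurable A -> mu (shift @^-1` A) = mu A.

Definition complete_grammar (chi : alphabetType) (R : realType)
    (nu : probability (seqspace chi) R) :=
  forall (n : nat) (w : n.-tuple chi), (1 <= n)%N -> (0 < nu (cylinder w))%E.

Section ShortestPath.
Context {R : realType} {chi : alphabetType}.

Definition path_lengths (n : nat) (x y : nat -> chi) : set nat :=
  [set k | (1 <= k)%N /\
    cylinder (mkseq y n) `&` (iter k shift @^-1` cylinder (mkseq x n)) !=set0].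

(* [path_lengths n x y] contains every k >= max(n, 1), so that this infimum is
   a minimum. *)
Definition shortest_path (n : nat) (x y : nat -> chi) : R :=
  inf [set k%:R | k in path_lengths n x y].

Definition path_deficit (n : nat) (xy : seqspace chi * seqspace chi) : R :=
  n%:R - shortest_path n xy.1 xy.2.

Lemma measurable_cylinder (w : seq chi) :
  measurable (cylinder w : set (seqspace chi)).
Proof. by apply: sub_sigma_algebra; exists w. Qed.

Lemma path_lengths_ge (n : nat) (x y : nat -> chi) (k : nat) :
  (1 <= k)%N -> (n <= k)%N -> path_lengths n x y k.
Proof.
move=> k0 nk; split => //.
have shiftE m (z : nat -> chi) i : iter m shift z i = z (m + i)%N.
  by elim: m i => [//|m IH] i; rewrite iterS /shift IH addnS addSn.
exists (fun i => if (i < k)%N then y i else x (i - k)%N); split.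
  rewrite /cylinder /= size_mkseq; apply/eq_in_map => i.
  by rewrite mem_iota add0n => /andP[_ /= ilt]; rewrite (leq_trans ilt).
rewrite /cylinder /= size_mkseq; apply/eq_in_map => i _.
by rewrite shiftE ltnNge leq_addr /= addKn.
Qed.

Lemma measurable_path_deficit (n : nat) :
  measurable_fun [set: seqspace chi * seqspace chi] (path_deficit n).
Proof.
move=> _ Y _; rewrite setTI.
pose u (m : nat) : set (seqspace chi * seqspace chi) :=
  if @unpickle (seq chi * seq chi)%type m is Some w then
    if `[< exists2 xy, path_deficit n xy \in Y &
           w = (mkseq xy.1 n, mkseq xy.2 n) >]
    then (cylinder w.1 : set (seqspace chi)) `*` cylinder w.2 else set0
  else set0.
rewrite (_ : _ @^-1` _ = \bigcup_m u m).
  apply: bigcupT_measurable => m; rewrite /u.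
  case: unpickle => [w|]; last exact: measurable0.
  case: ifP => _; last exact: measurable0.
  by apply: measurableX; exact: measurable_cylinder.
apply/seteqP; split => [[x y] /= Yxy|[x y] [m _]].
  exists (pickle (mkseq x n, mkseq y n)) => //; rewrite /u pickleK.
  rewrite asboolT; last by exists (x, y) => //; exact/mem_set.
  by split; rewrite /cylinder /= size_mkseq.
rewrite /u; case: unpickle => [w|//].
case: ifPn => // /asboolP[[x' y'] /= /set_mem Y' ->] [].
rewrite /cylinder /= !size_mkseq => ex ey.
by move: Y'; rewrite /path_deficit /shortest_path /path_lengths /= ex ey.
Qed.

HB.instance Definition _ (n : nat) :=
  isMeasurableFun.Build _ _ _ _ (path_deficit n) (measurable_path_deficit n).

End ShortestPath.

Definition cvg_in_probability d (T : measurableType d) (R : realType)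
    (P : probability T R) (X : nat -> {RV P >-> R}) (Z : {RV P >-> R}) :=
  forall eps : R, 0 < eps ->
    P [set t | eps <= `|X n t - Z t|] @[n --> \oo] --> (0 : \bar R).

(* Main.v *)
(* If y_(n-1) = x_0, then T_n <= n-1.  When moreover n - T_n and
   (n+1) - T_(n+1) agree, T_(n+1) = T_n + 1, so x_(n-1-T_n) is matched with
   y_(n-1) by the first path and with y_n by the second, whence y_n = y_(n-1).
   Thus for letters b != a the integers n - T_n and (n+1) - T_(n+1) differ
   whenever x_0 = a and y_(n-1) y_n = ab, an event whose probability
   mu(a) * nu(ab) does not depend on n and is positive for a suitable a.
   On a one-letter alphabet, T_n = 1 for all n. *)
Require Import Defs.
From mathcomp Require Import all_boot all_order all_algebra.
From mathcomp Require Import all_classical all_reals all_analysis.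
From mathcomp Require Import zify ring lra.

Set Implicit Arguments.
Unset Strict Implicit.
Unset Printing Implicit Defensive.

Import Order.TTheory GRing.Theory Num.Theory.
Import numFieldNormedType.Exports.

Local Open Scope classical_set_scope.
Local Open Scope ring_scope.

Lemma iter_shiftE (chi : alphabetType) k (x : nat -> chi) i :
  iter k Defs.shift x i = x (k + i)%N.
Proof.
by elim: k i => [//|k IH] i; rewrite iterS /Defs.shift IH addnS addSn.
Qed.

Lemma mkseq_shift (chi : alphabetType) (x : nat -> chi) n :
  mkseq x n.+1 = x 0%N :: mkseq (Defs.shift x) n.
Proof. by rewrite /mkseq /= (iotaDl 1 0) -map_comp. Qed.

Lemma eq_mkseqP (T : Type) (f g : nat -> T) n :
  mkseq f n = mkseq g n <-> forall i, (i < n)%N -> f i = g i.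
Proof.
split=> [e i ilt|e].
  by rewrite -(nth_mkseq (f 0) f ilt) e nth_mkseq.
elim: n e => [//|n IH] e; rewrite !mkseqS e // IH // => i ilt.
by apply: e; rewrite ltnS ltnW.
Qed.

(** A point of the intersection is prescribed by y on [0, n) and by x on [k, k + n), so the only
    constraint is agreement on the overlap [k, n). *)
Lemma path_lengthsP (chi : alphabetType) n (x y : nat -> chi) k :
  path_lengths n x y k <->
  (1 <= k)%N /\ forall i, (k + i < n)%N -> y (k + i)%N = x i.
Proof.
split=> [[k1 [z []]]|[k1 yx]].
  rewrite /cylinder /= !size_mkseq => /eq_mkseqP zy /eq_mkseqP zx.
  split=> // i ilt; rewrite -zy // -zx ?iter_shiftE //.
  exact: leq_ltn_trans (leq_addl _ _) ilt.
split=> //; exists (fun i => if (i < k)%N then y i else x (i - k)%N).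
rewrite /cylinder /= !size_mkseq; split; apply/eq_mkseqP => i ilt.
  case: ltnP => // ki; rewrite -[in RHS](subnKC ki) yx //.
  by rewrite subnKC.
by rewrite iter_shiftE ltnNge leq_addr addKn.
Qed.

Lemma shortest_pathP (R : realType) (chi : alphabetType) n (x y : nat -> chi) :
  exists k, [/\ path_lengths n x y k,
    forall j, path_lengths n x y j -> (k <= j)%N &
    shortest_path n x y = k%:R :> R].
Proof.
have ex : exists k, `[< path_lengths n x y k >].
  (* [n.+1] rather than n, since lengths start at 1 even for n = 0. *)
  exists n.+1; apply/asboolP; exact: path_lengths_ge.
case: (ex_minnP ex) => k /asboolP pk kmin; exists k.
have kmin' j : path_lengths n x y j -> (k <= j)%N by move=> /asboolP /kmin.
split=> //; apply/le_anti/andP; split.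
  apply: ge_inf; last by exists k.
  by exists 0 => _ [j _ <-].
by apply: lb_le_inf; [exists k%:R, k | move=> _ [j /kmin' kj <-]; rewrite ler_nat].
Qed.

(** The hypothesis on b covers all alphabets at once: either b differs from a, or a is the only
    letter. *)
Lemma path_deficit_jump (R : realType) (chi : alphabetType) n
    (xy : (nat -> chi) * (nat -> chi)) a b :
  (b = a -> forall c, c = a) ->
  xy.1 0%N = a -> xy.2 n.+1 = a -> xy.2 n.+2 = b ->
  1 <= `|path_deficit n.+2 xy - path_deficit n.+3 xy : R|.
Proof.
case: xy => x y /= ba x0 ya yb; rewrite /path_deficit /=.
have [k [/path_lengthsP[k1 pk] kmin ->]] := shortest_pathP R n.+2 x y.
have [l [/path_lengthsP[l1 pl] lmin ->]] := shortest_pathP R n.+3 x y.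
(* This bound ensures that the subtraction [n.+1 - k] below is not truncated. *)
have kn : (k <= n.+1)%N.
  apply: kmin; apply/path_lengthsP; split=> // i.
  by case: i => [|i]; [rewrite addn0 ya x0 | lia].
have lk : (l <> k.+1)%N.
  move=> lk; have bEa : b = a.
    have := pl (n.+1 - k)%N; have := pk (n.+1 - k)%N.
    rewrite lk addSn subnKC // ya yb => -> // => -> //.
  (* With a single letter every length k >= 1 is admissible, whereas l = k + 1 >= 2. *)
  have : (l <= 1)%N; last by lia.
  by apply: lmin; apply/path_lengthsP; split=> // i _;
    rewrite (ba bEa (x i)) (ba bEa (y _)).
have := lk; move: (n.+2) => p {}lk.
(* The jump is a nonzero integer, hence at least 1 in absolute value. *)
have -> : p%:R - k%:R - (p.+1%:R - l%:R) = (l%:Z - k.+1%:Z)%:~R :> R.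
  by rewrite intrB -!pmulrn -!natr1; ring.
rewrite -intr_norm ler1z; lia.
Qed.

Section Measure.
Context {R : realType} {chi : alphabetType}.

Lemma measurable_shift :
  measurable_fun [set: seqspace chi] (Defs.shift : seqspace chi -> seqspace chi).
Proof.
apply: (measurability (cylinders chi : set (set (seqspace chi))))
  => // _ [_ [w _ <-] <-].
rewrite setTI (_ : _ @^-1` _ = \bigcup_a cylinder (a :: w)).
  by apply: countable_bigcupT_measurable => // a; exact: measurable_cylinder.
rewrite /cylinder; apply/seteqP; split=> [x xw|x [a _]] /=.
  by exists (x 0%N) => //=; rewrite mkseq_shift xw.
by rewrite mkseq_shift => -[].
Qed.

Lemma measurable_iter_shift n (A : set (seqspace chi)) :
  measurable A -> measurable (iter n Defs.shift @^-1` A : set (seqspace chi)).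
Proof.
elim: n A => [//|n IH] A mA.
rewrite (_ : _ @^-1` _ = iter n Defs.shift @^-1` (Defs.shift @^-1` A)) //.
by apply: IH; rewrite -[X in measurable X]setTI; exact: measurable_shift.
Qed.

Lemma stationary_iter (mu : probability (seqspace chi) R) n
    (A : set (seqspace chi)) :
  stationary mu -> measurable A -> mu (iter n Defs.shift @^-1` A) = mu A.
Proof.
move=> st; elim: n A => [//|n IH] A mA.
rewrite (_ : _ @^-1` _ = iter n Defs.shift @^-1` (Defs.shift @^-1` A)) //.
rewrite IH ?st // -[X in measurable X]setTI; exact: measurable_shift.
Qed.

(** Countably many one-letter cylinders cover the space, so they cannot all be null. *)
Lemma cylinder1_gt0 (mu : probability (seqspace chi) R) :
  exists a : chi, (0 < mu (cylinder [:: a]))%E.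
Proof.
apply: contrapT => /forallNP mu0.
pose F k : set (seqspace chi) :=
  if @unpickle chi k is Some a then cylinder [:: a] else set0.
have /negligible_bigcup : forall k, mu.-negligible (F k).
  move=> k; rewrite /F; case: unpickle => [a|]; last exact: negligible_set0.
  apply/negligibleP; first exact: measurable_cylinder.
  by apply/eqP; rewrite -measure_le0 leNgt; apply/negP/mu0.
rewrite (_ : \bigcup_k _ = setT).
  move=> /(negligibleP _ measurableT) mu0T.
  by have := @onee_neq0 R; rewrite -(@probability_setT _ _ _ mu) mu0T eqxx.
apply/seteqP; split=> // x _; exists (pickle (x 0%N)) => //.
by rewrite /F pickleK.
Qed.

End Measure.

(** A jump of size 1 puts X n or X (n+1) at distance at least 1/2 from Z. Hence E n eventually lies
    in a union of two events whose probabilities tend to 0, against the uniform bound c. *)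
Lemma jump_not_cvg_in_probability d (T : measurableType d) (R : realType)
    (P : probability T R) (X : nat -> {RV P >-> R}) (Z : {RV P >-> R})
    (E : nat -> set T) (c : \bar R) :
  cvg_in_probability X Z -> (0 < c)%E ->
  (forall n, measurable (E n)) -> (forall n, (c <= P (E n))%E) ->
  (\forall n \near \oo, forall t, E n t -> 1 <= `|X n t - X n.+1 t|) -> False.
Proof.
move=> XZ c0 mE cE jump.
have half0 : 0 < 2^-1 :> R by rewrite invr_gt0.
have cvg0 := XZ _ half0.
pose A n := [set t | 2^-1 <= `|X n t - Z t|].
have mA n : measurable (A n).
  rewrite -[A n]setTI; apply: measurable_fun_le => //.
  apply: measurableT_comp => //; exact: measurable_realfun.measurable_funB.
have cvg1 : P (A n.+1) @[n --> \oo] --> (0 : \bar R).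
  by rewrite (cvg_shiftS (P \o A)).
have := cvgeD _ cvg0 cvg1; rewrite adde0 => /(_ _ isT) cvg2.
have : (c <= 0)%E.
  apply: (cvge_ge _ cvg2); apply: filterS jump => n jump.
  apply: (le_trans (cE n)); apply: le_trans (measureU2 _ (mA n) (mA n.+1)).
  apply: le_measure; rewrite ?inE //; first exact: measurableU.
  move=> t /jump J; apply/orP; rewrite /A /=.
  rewrite -implyNb -ltNge; apply/implyP => lt1.
  have := ler_distD (Z t) (X n t) (X n.+1 t); rewrite (distrC (Z t)); lra.
by rewrite leNgt c0.
Qed.

Theorem proposition6p1 (R : realType) (chi : alphabetType)
    (mu nu : probability (seqspace chi) R)
    (mu_stationary : stationary mu) (nu_stationary : stationary nu)
    (nu_complete : complete_grammar nu) :
  ~ exists Z : {RV (mu \x nu)%E >-> R},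
      cvg_in_probability (fun n => path_deficit n : {RV (mu \x nu)%E >-> R}) Z.
Proof.
move=> [Z cvgZ].
have [a mua] := cylinder1_gt0 mu.
have [b ba] : exists b, b = a -> forall c, c = a.
  have [all_a|/existsNP[b bNa]] := pselect (forall c, c = a); first by exists a.
  by exists b => /bNa.
(* The word ab is read at y_(n-1) y_n: the last letter of the prefix of length n and the next
   one. *)
pose E n : set (seqspace chi * seqspace chi) :=
  cylinder [:: a] `*` (iter n.-1 Defs.shift @^-1` cylinder [:: a; b]).
have ma : measurable (cylinder [:: a] : set (seqspace chi)).
  exact: measurable_cylinder.
have mab : measurable (cylinder [:: a; b] : set (seqspace chi)).
  exact: measurable_cylinder.
have mE n : measurable (E n).
  by apply: measurableX => //; exact: measurable_iter_shift.
apply: (jump_not_cvg_in_probability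
  (c := (mu (cylinder [:: a]) * nu (cylinder [:: a; b]))%E) cvgZ _ mE).
- by rewrite mule_gt0 // (nu_complete 2%N [tuple a; b]).
- move=> n; rewrite -(stationary_iter n.-1 nu_stationary mab).
  by rewrite -(product_measure1E mu nu ma (measurable_iter_shift _ mab)).
(* From n = 2 on, n - 1 is at least 1 and thus can be a path length. *)
- exists 2%N => // -[|[|n]] // _ [x y] [/= [x0]].
  rewrite /cylinder /= /mkseq /= -!iterS !iter_shiftE addn0 addn1 => -[ya yb].
  exact (@path_deficit_jump R _ n (x, y) _ _ ba x0 ya yb).
Qed.
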